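(* For every $n\geq 3$, the independence system $(C_n)_{\mathrm{res}}$ on the vertex set of the cycle graph $C_n$, whose independent sets are the subsets of minimal resolving sets of $C_n$, is a matroid.
   Context: $C_n$ is the cycle on $n$ vertices. For a connected graph $G$, $d(u,w)$ is the shortest-path distance; $R\subseteq V(G)$ is a resolving set if for any two distinct vertices $u,w$ there is $h\in R$ with $d(u,h)\ne d(w,h)$, and it is minimal if no proper subset of it is resolving. A matroid is an independence system such that for any independent sets $A,B$ with $|A|<|B|$ there is $x\in B\setminus A$ with $A\cup\{x\}$ independent. *)

(* Defs.v *)
From mathcomp Require Import all_boot.

Set Implicit Arguments.
Unset Strict Implicit.
Unset Printing Implicit Defensive.

(* A simple graph is given by its adjacency relation e on a finite type. *)
Section Resolving.
Variables (T : finType) (e : rel T).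

Definition walk_of_length (u w : T) (k : nat) : bool :=
  [exists p : k.-tuple T, path e u p && (last u p == w)].

(* If w is not reachable from u then no k qualifies and the value is #|T|;
   see dist_walk and dist_min for the reachable case. *)
Definition dist (u w : T) : nat := find (walk_of_length u w) (iota 0 #|T|).

Definition resolving (R : {set T}) : bool :=
  [forall u, forall w, (u != w) ==> [exists h in R, dist u h != dist w h]].

Definition minimal_resolving (R : {set T}) : bool := minset resolving R.

Definition res_system : {set {set T}} :=
  [set A : {set T} | [exists R : {set T}, minimal_resolving R && (A \subset R)]].

Lemma walk_of_lengthP u w p :
  path e u p -> last u p = w -> walk_of_length u w (size p).
Proof.
by move=> pp lp; apply/existsP; exists (in_tuple p); rewrite /= pp lp eqxx.
Qed.

Lemma dist_lt u w : connect e u w -> dist u w < #|T|.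
Proof.
case/connectP=> p pp ->; case: (shortenP pp) => q pq uq _.
rewrite -[X in _ < X](size_iota 0) -has_find; apply/hasP; exists (size q).
  by rewrite mem_iota /= add0n -[_.+1]/(size (u :: q)) -(card_uniqP uq) max_card.
exact: walk_of_lengthP pq erefl.
Qed.

Lemma dist_walk u w : connect e u w -> walk_of_length u w (dist u w).
Proof.
move=> cuw; have lt := dist_lt cuw.
have h : has (walk_of_length u w) (iota 0 #|T|) by rewrite has_find size_iota.
by have := nth_find 0 h; rewrite nth_iota.
Qed.

Lemma dist_min u w p : path e u p -> last u p = w -> dist u w <= size p.
Proof.
move=> pp lp; rewrite leqNgt; apply/negP => lt.
have := before_find 0 lt; rewrite nth_iota ?add0n ?(walk_of_lengthP pp lp) //.
by apply: leq_trans lt _; rewrite -[X in _ <= X](size_iota 0) find_size.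
Qed.

End Resolving.

Section Matroid.
Variable T : finType.

Definition independence_system (I : {set {set T}}) : Prop :=
  set0 \in I /\ forall A B : {set T}, A \in I -> B \subset A -> B \in I.

Definition matroid (I : {set {set T}}) : Prop :=
  independence_system I /\
  forall A B : {set T}, A \in I -> B \in I -> #|A| < #|B| ->
    exists x, x \in B :\: A /\ x |: A \in I.

End Matroid.

Definition cycle_graph (n : nat) : rel 'I_n :=
  fun u v => (v == u.+1 %% n :> nat) || (u == v.+1 %% n :> nat).

Lemma cycle_graph_sym n : symmetric (@cycle_graph n).
Proof. by move=> u v; rewrite /cycle_graph orbC. Qed.

(* For n = 1 the relation has a loop. *)
Lemma cycle_graph_irr n : 1 < n -> irreflexive (@cycle_graph n).
Proof.
move=> n1 u; rewrite /cycle_graph orbb; apply/negbTE.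
have := ltn_ord u; rewrite leq_eqVlt => /orP[/eqP un|un].
  by rewrite un modnn -eqSS un eqn_leq leqNgt n1.
by rewrite modn_small // neq_ltn ltnSn.
Qed.

(* Main.v *)
Require Import Defs.
From mathcomp Require Import all_boot zify.

(** A vertex [h] of the cycle fails to separate [u] and [w], [u != w], exactly
    when [u + w = 2h] modulo [n]. Hence a set is resolving iff doubling modulo
    [n] is not constant on it: if [2h] is the same for all [h] in the set, the
    two neighbours of a member are not separated. The minimal resolving sets are
    thus the pairs on which doubling is injective, so the independent sets are
    the partial transversals, of size at most 2, of the fibres of doubling. *)

Section FibrePairs.
Variables (T : finType) (V : eqType) (f : T -> V) (P : pred {set T}).
Hypothesis PE : forall R : {set T},
  reflect (exists a b, [/\ a \in R, b \in R & f a != f b]) (P R).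

Lemma nonconst_pair a b : f a != f b -> P [set a; b].
Proof. by move=> fab; apply/PE; exists a, b; rewrite !inE !eqxx orbT. Qed.

(** A pair witnessing [P R] already satisfies [P], so minimality makes it all of [R]. Conversely, a
    subset of [[set a; b]] on which [f] is not constant must contain both points. *)
Lemma minset_nonconstP (R : {set T}) :
  reflect (exists a b, R = [set a; b] /\ f a != f b) (minset P R).
Proof.
apply: (iffP idP) => [/minsetP[/PE[a [b [aR bR fab]]] minR] | [a [b [-> fab]]]].
  exists a, b; split=> //; apply/esym/minR; first exact: nonconst_pair.
  by apply/subsetP => x; rewrite !inE => /orP[]/eqP->.
apply/minsetP; split=> [|S /PE[c [d [cS dS fcd]]] sS]; first exact: nonconst_pair.
apply/eqP; rewrite eqEsubset sS /=; apply/subsetP => x.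
move: (subsetP sS _ cS) (subsetP sS _ dS) fcd; rewrite !inE.
by case/orP=> /eqP ec; case/orP=> /eqP ed; subst c d; rewrite ?eqxx // => _;
   case/orP=> /eqP->.
Qed.

Lemma nonconst_matroid : P setT ->
  matroid [set A : {set T} | [exists R : {set T}, minset P R && (A \subset R)]].
Proof.
set I := [set A | _]; case/PE=> a0 [b0 [_ _ fab0]].
have inI (A : {set T}) a b : f a != f b -> A \subset [set a; b] -> A \in I.
  move=> fab sA; rewrite inE; apply/existsP; exists [set a; b].
  by rewrite sA andbT; apply/minset_nonconstP; exists a, b.
have outI (A : {set T}) : A \in I -> exists a b, f a != f b /\ A \subset [set a; b].
  rewrite inE => /existsP[R /andP[/minset_nonconstP[a [b [-> fab]]] sA]].
  by exists a, b.
have downI (A B : {set T}) : A \in I -> B \subset A -> B \in I.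
  by move=> /outI[a [b [fab sA]]] sB; apply: inI _ _ _ fab (subset_trans sB sA).
split; first by split=> //; exact: inI _ _ _ fab0 (sub0set _).
move=> A B AI BI ltAB; have [A0|[a aA]] := set_0Vmem A.
  have /card_gt0P[x xB] : 0 < #|B| by apply: leq_ltn_trans ltAB.
  by exists x; rewrite A0 inE in_set0 xB setU0; split=> //; rewrite (downI B) ?sub1set.
have [b [c [fbc sB]]] := outI _ BI.
have leB : #|B| <= #|[set b; c]| := subset_leq_card sB.
have bc2 : #|[set b; c]| <= 2 by rewrite cards2; case: (_ != _).
have A1 : A = [set a].
  by apply/esym/eqP; rewrite eqEcard sub1set aA cards1; lia.
have BE : B = [set b; c].
  by apply/eqP; rewrite eqEcard sB; move: ltAB; rewrite A1 cards1; lia.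
(* As [f] takes two values on [B], one of them differs from [f a]; this also forces [x != a]. *)
have [x xB fxa] : exists2 x, x \in B & f x != f a.
  have [fba|fba] := eqVneq (f b) (f a); last by exists b; rewrite ?BE ?set21.
  by exists c; rewrite ?BE ?set22 // -fba eq_sym.
exists x; split; last by apply: inI _ _ _ fxa _; rewrite A1.
by rewrite !inE xB andbT A1 inE; apply: contraNneq fxa => ->.
Qed.

End FibrePairs.

Section Cycle.
Variables (n : nat) (n3 : 3 <= n).
Local Notation e := (@cycle_graph n).

(** Subtraction is truncated, so [d] is the absolute difference of [u] and [w]. *)
Definition cycle_dist (u w : nat) : nat :=
  let d := (u - w) + (w - u) in minn d (n - d).

(* Doubling modulo [n] of a residue [h < n]; the explicit reduction keeps the
   arithmetic goals linear. *)
Definition double_mod (h : nat) : nat := if h + h < n then h + h else h + h - n.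

(** Eliminates the modulus, leaving adjacency in a form that [lia] can handle. *)
Lemma cycle_graphE (u v : 'I_n) :
  e u v = [|| v == u.+1 :> nat, u == v.+1 :> nat,
              (v == 0 :> nat) && (u.+1 == n) | (u == 0 :> nat) && (v.+1 == n)].
Proof.
have S_mod (x : 'I_n) : x.+1 %% n = if x.+1 == n then 0 else x.+1.
  case: eqP => [->|ne]; rewrite ?modnn // modn_small //.
  by have := ltn_ord x; lia.
rewrite /cycle_graph !S_mod; have := ltn_ord u; have := ltn_ord v.
by case: (u.+1 =P n) => ?; case: (v.+1 =P n) => ?; lia.
Qed.

Lemma cycle_neighbours (u : 'I_n) : exists x y : 'I_n,
  (x = u.+1 :> nat \/ u.+1 = n /\ x = 0 :> nat) /\
  (u = y.+1 :> nat \/ u = 0 :> nat /\ y.+1 = n).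
Proof.
have lu := ltn_ord u.
have lx : (if u.+1 == n then 0 else u.+1) < n by case: eqP; lia.
have ly : (if u == 0 :> nat then n.-1 else u.-1) < n by case: eqP; lia.
exists (Ordinal lx), (Ordinal ly) => /=.
by case: (u.+1 =P n); case: (nat_of_ord u =P 0); lia.
Qed.

Lemma cycle_dist_step (u v w : 'I_n) :
  e u v -> cycle_dist u w <= (cycle_dist v w).+1.
Proof.
rewrite cycle_graphE /cycle_dist.
by have := ltn_ord u; have := ltn_ord v; have := ltn_ord w; lia.
Qed.

Lemma cycle_dist_path (u : 'I_n) (p : seq 'I_n) :
  path e u p -> cycle_dist u (last u p) <= size p.
Proof.
elim: p u => [|v p IH] u /=; first by rewrite /cycle_dist; lia.
by case/andP=> uv /IH le; apply: leq_trans (cycle_dist_step _ _ _ uv) _.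
Qed.

Lemma cycle_dist_geodesic (u w : 'I_n) :
  exists p, [/\ path e u p, last u p = w & size p = cycle_dist u w].
Proof.
move Dk : (cycle_dist u w) => k.
elim: k u Dk => [|k IH] u Dk.
  exists [::]; split=> //=; apply: val_inj => /=; move: Dk.
  by rewrite /cycle_dist; have := ltn_ord u; have := ltn_ord w; lia.
suff [v uv /IH[p [pp lp sp]]] : exists2 v : 'I_n, e u v & cycle_dist v w = k.
  by exists (v :: p); rewrite /= uv sp.
have lu := ltn_ord u; have lw := ltn_ord w.
have [x [y [xE yE]]] := cycle_neighbours u.
have : cycle_dist x w = k \/ cycle_dist y w = k.
  (* Move along the shorter arc: towards [w] if the direct arc is at most half the cycle, otherwise
     away from [w] and around through 0. *)
  move: Dk; rewrite /cycle_dist.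
  by case: (ltnP u w) => uw; case: (leqP (u - w + (w - u)).*2 n) => le2d Dk;
    [left; clear yE | right; clear xE | right; clear xE | left; clear yE]; lia.
by case=> Dv; [exists x | exists y]; rewrite // cycle_graphE; lia.
Qed.

(** The geodesic gives the upper bound; the lower bound holds because [cycle_dist] drops by at most
    one along each edge of a walk. *)
Lemma dist_cycle (u w : 'I_n) : dist e u w = cycle_dist u w.
Proof.
have [p [pp lp sp]] := cycle_dist_geodesic u w.
apply/eqP; rewrite eqn_leq -{1}sp (dist_min pp lp) /=.
have /dist_walk/existsP[q /andP[pq /eqP lq]] : connect e u w by apply/connectP; exists p.
by have := cycle_dist_path _ _ pq; rewrite lq size_tuple.
Qed.

(** Equal distances mean that [u - h] is plus or minus [w - h] modulo [n], and [u != w] excludes the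
    plus sign. *)
Lemma cycle_dist_eq (u w h : nat) : u < n -> w < n -> h < n -> u != w ->
  cycle_dist u h = cycle_dist w h ->
  double_mod h = if u + w < n then u + w else u + w - n.
Proof.
move=> lu lw lh uw; rewrite /cycle_dist /double_mod.
by case: (ltnP (h + h) n); case: (ltnP (u + w) n); lia.
Qed.

Lemma resolving_cycleP (R : {set 'I_n}) :
  reflect (exists a b, [/\ a \in R, b \in R & double_mod a != double_mod b])
          (resolving e R).
Proof.
apply: (iffP idP) => [|[a [b [aR bR fab]]]]; last first.
  apply/forallP => u; apply/forallP => w; apply/implyP => uw.
  apply: contraNT fab; rewrite negb_exists => /forallP noR.
  have sep h : h \in R -> cycle_dist u h = cycle_dist w h.
    by move=> hR; have := noR h; rewrite hR negbK !dist_cycle => /eqP.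
  by rewrite !(@cycle_dist_eq u w) ?sep.
move/forallP => resR.
have [R0|[a aR]] := set_0Vmem R.
  have l0 : 0 < n by lia.
  have l1 : 1 < n by lia.
  have /forallP/(_ (Ordinal l1)) := resR (Ordinal l0).
  by rewrite -val_eqE => /existsP[h]; rewrite R0 inE.
have la := ltn_ord a.
have [x [y [xE yE]]] := cycle_neighbours a.
have /forallP/(_ y) := resR x.
(* The two neighbours of [a] are distinct because [3 <= n]. *)
have -> /= : x != y by rewrite -val_eqE /=; lia.
case/existsP=> b /andP[bR]; rewrite !dist_cycle => nab.
(* If the doubles agree, [b] is [a] or its antipode, hence equidistant from both neighbours of
   [a]. *)
exists a, b; split=> //; apply: contraNneq nab.
have lb := ltn_ord b; rewrite /double_mod /cycle_dist.
by case: (ltnP (a + a) n); case: (ltnP (b + b) n); lia.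
Qed.

End Cycle.

Theorem theorem6 (n : nat) (hn : 3 <= n) :
  matroid (res_system (@cycle_graph n)).
Proof.
apply: (nonconst_matroid _ _ _ _ (resolving_cycleP n hn)).
apply/(resolving_cycleP n hn).
have l0 : 0 < n by lia.
have l1 : 1 < n by lia.
exists (Ordinal l0), (Ordinal l1); rewrite !inE; split=> //.
(* Since [2 < n], doubling sends 0 and 1 to 0 and 2. *)
by rewrite /double_mod /= l0 hn.
Qed.
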